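(* Let $l\ge1$, $\vec n=(n_l,\dots,n_0)$ with all $n_i\ge1$, $\mu>0$, $1\le p<\infty$, $0<q\le\infty$, and let $\mathcal C^{l,\vec n}_{\mu_{p,q}\le\mu}=\{\vec C_l\in\mathcal C^{l,\vec n}:\mu_{p,q}(\vec C_l)\le\mu\}$. Then for every sample $S=(\vec x_1,\dots,\vec x_m)$: (1) if $1\le p\le2$, $R_S(\mathcal F\circ\mathcal C^{l,\vec n}_{\mu_{p,q}\le\mu})\le\mu\,4^{(\sum_{i=1}^ln_i)\max\{1/p^*,1/q\}}\frac{\sqrt{\min\{p^*,8n_0\}}}{\sqrt m}K_p(S,H)$; (2) if $2<p<\infty$, $R_S(\mathcal F\circ\mathcal C^{l,\vec n}_{\mu_{p,q}\le\mu})\le\mu\,4^{(\sum_{i=1}^ln_i)\max\{1/p^*,1/q\}}\frac{\sqrt{p^*}}{m^{1/p}}K_p(S,H)$.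
   Context: Pauli notation $P_{\vec z}$ as tensor products of $P_0=\mathbb I,P_1=X,P_2=Y,P_3=Z$. Representation matrix of a linear map $\Phi$ from $a$ to $b$ qubits: $M^\Phi_{\vec z\vec x}=2^{-b}\mathrm{Tr}(P_{\vec z}\Phi(P_{\vec x}))$. Group norm: $\|M\|_{p,q}=(\frac1{N_1}\sum_i\|M_i\|_p^q)^{1/q}$ for an $N_1\times N_2$ matrix with rows $M_i$ ($\max_i\|M_i\|_p$ if $q=\infty$). $p^*$ is the Hölder conjugate. $\mathcal C^{l,\vec n}$ is the set of depth-$l$ circuits $\vec C_l=(\Phi_l,\dots,\Phi_1)$ with $\Phi_i$ a quantum channel from $n_{i-1}$ to $n_i$ qubits, implementing $C_l=\Phi_l\circ\cdots\circ\Phi_1$. $\mu_{p,q}(\vec C_l)=\prod_{i=1}^l\|M^{\Phi_i}\|_{p,q}$. Setup: data encoded as $n_0$-qubit pure states $\rho(\vec x)$, $H$ Hermitian on $n_l$ qubits, $f_{\vec C_l}(\vec x)=\mathrm{Tr}(C_l(\rho(\vec x))H)$; $R_S(\mathcal G)=\mathbb E_{\vec\epsilon}\frac1m\sup_{g\in\mathcal G}|\sum_i\epsilon_ig(\vec x_i)|$ with i.i.d. uniform signs. $\vec\alpha\in\mathbb R^{4^{n_l}}$ has entries $\mathrm{Tr}(P_{\vec z}H)$, $\vec f_I(\vec x)\in\mathbb R^{4^{n_0}}$ has entries $2^{-n_0}\mathrm{Tr}(P_{\vec z}\rho(\vec x))$, $K_p(S,H)=\|\vec\alpha\|_p\max_i\|\vec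 f_I(\vec x_i)\|_{p^*}$. *)

(* Defs.v *)
From mathcomp Require Import all_boot all_order all_algebra.
From mathcomp Require Import all_classical all_reals all_analysis.
From mathcomp Require Export complex.
Import Order.TTheory GRing.Theory Num.Theory.

Set Implicit Arguments.
Unset Strict Implicit.
Unset Printing Implicit Defensive.

Local Open Scope ring_scope.

Section QDefs.
Variable R : realType.
Local Notation C := R[i].

(** single-qubit Paulis P_0 = I, P_1 = X, P_2 = Y, P_3 = Z;
    pauli1 k a b is the (a,b) entry, with false = |0>, true = |1>. *)
Definition pauli1 (k : 'I_4) (a b : bool) : C :=
  match val k with
  | 0 => if a == b then 1 else 0
  | 1 => if a == b then 0 else 1
  | 2 => if a == b then 0 else (if a then 'i%C else - 'i%C)
  | _ => if a == b then (if a then -1 else 1) else 0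
  end.

Definition pidx (n : nat) := {ffun 'I_n -> 'I_4}.

Definition qbit (k i : nat) : bool := odd (i %/ 2 ^ k).

(** P_z = P_{z_0} (x) ... (x) P_{z_{n-1}}, written entrywise *)
Definition pauli (n : nat) (z : pidx n) : 'M[C]_(2 ^ n) :=
  \matrix_(i, j) \prod_(k < n) pauli1 (z k) (qbit k i) (qbit k j).

Definition psdf (T : finType) (A : T -> T -> C) : Prop :=
  forall v : T -> C, 0 <= \sum_s \sum_t (v s)^*%C * A s t * v t.

(** quantum channel from a to b qubits: linear, trace preserving,
    completely positive (id_k (x) Phi is positive for every k). *)
Definition is_channel (a b : nat) (Phi : 'M[C]_(2 ^ a) -> 'M[C]_(2 ^ b)) : Prop :=
  [/\ (forall (c : C) (X Y : 'M[C]_(2 ^ a)), Phi (c *: X + Y) = c *: Phi X + Phi Y),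
      (forall X : 'M[C]_(2 ^ a), \tr (Phi X) = \tr X) &
      (forall (k : nat) (X : 'I_k * 'I_(2 ^ a) -> 'I_k * 'I_(2 ^ a) -> C),
         psdf X ->
         psdf (fun u w : 'I_k * 'I_(2 ^ b) =>
                 Phi (\matrix_(i, j) X (u.1, i) (w.1, j)) u.2 w.2))].

(** representation matrix M^Phi_{z x} = 2^{-b} Tr(P_z Phi(P_x))
    (real for channels; we take the real part) *)
Definition repmx (a b : nat) (Phi : 'M[C]_(2 ^ a) -> 'M[C]_(2 ^ b))
  (z : pidx b) (x : pidx a) : R :=
  (2%:R ^+ b)^-1 * complex.Re (\tr (pauli z *m Phi (pauli x))).

Definition lpnorm (T : finType) (p : \bar R) (v : T -> R) : R :=
  match p with
  | r%:E => (\sum_t `|v t| `^ r) `^ r^-1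
  | +oo%E => \big[Num.max/0]_t `|v t|
  | -oo%E => 0
  end.

Definition groupnorm (T1 T2 : finType) (p : R) (q : \bar R) (M : T1 -> T2 -> R) : R :=
  match q with
  | r%:E => ((#|T1|%:R)^-1 * \sum_i (lpnorm p%:E (M i)) `^ r) `^ r^-1
  | +oo%E => \big[Num.max/0]_i lpnorm p%:E (M i)
  | -oo%E => 0
  end.

Definition hconj (p : R) : \bar R := if p == 1 then +oo%E else (p / (p - 1))%:E.

Definition inv_ext (q : \bar R) : R := if q is r%:E then r^-1 else 0.

Definition minconj (p c : R) : R :=
  if hconj p is r%:E then Num.min r c else c.

(** composition of the first k layers of a circuit;
    layer k maps n k qubits to n (k+1) qubits (layer k is Phi_{k+1} of the paper) *)
Fixpoint circ (n : nat -> nat)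
  (Phi : forall k : nat, 'M[C]_(2 ^ n k) -> 'M[C]_(2 ^ n k.+1)) (k : nat) :
  'M[C]_(2 ^ n 0%N) -> 'M[C]_(2 ^ n k) :=
  match k return 'M[C]_(2 ^ n 0%N) -> 'M[C]_(2 ^ n k) with
  | 0 => fun X => X
  | k'.+1 => fun X => Phi k' (circ Phi k' X)
  end.

Definition mupq (l : nat) (n : nat -> nat)
  (Phi : forall k : nat, 'M[C]_(2 ^ n k) -> 'M[C]_(2 ^ n k.+1)) (p : R) (q : \bar R) : R :=
  \prod_(k < l) groupnorm p q (repmx (Phi k)).

Definition circ_class (X : Type) (l : nat) (n : nat -> nat) (p : R) (q : \bar R) (mu : R)
  (rho : X -> 'M[C]_(2 ^ n 0%N)) (H : 'M[C]_(2 ^ n l)) : set (X -> R) :=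
  [set g | exists Phi : forall k : nat, 'M[C]_(2 ^ n k) -> 'M[C]_(2 ^ n k.+1),
     [/\ forall k, (k < l)%N -> is_channel (Phi k),
         mupq l Phi p q <= mu &
         g = fun x => complex.Re (\tr (circ Phi l (rho x) *m H))]].

(** empirical Rademacher complexity (extended-real valued, so that no
    boundedness is presupposed) *)
Definition rademacher (X : Type) (m : nat) (S : 'I_m -> X) (G : set (X -> R)) : \bar R :=
  (((2%:R ^+ m)^-1)%:E *
   \sum_(eps : {ffun 'I_m -> bool})
      (((m%:R)^-1)%:E *
       ereal_sup [set (`| \sum_(i < m) (if eps i then -1 else 1) * g (S i) |)%:E
                 | g in G]))%E.

Definition Kp (X : Type) (m a b : nat) (p : R) (S : 'I_m -> X)
  (rho : X -> 'M[C]_(2 ^ a)) (H : 'M[C]_(2 ^ b)) : R :=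
  lpnorm p%:E (fun z : pidx b => complex.Re (\tr (pauli z *m H))) *
  \big[Num.max/0]_(i < m)
     lpnorm (hconj p) (fun z : pidx a => (2%:R ^+ a)^-1 * complex.Re (\tr (pauli z *m rho (S i)))).

Definition pure_state (d : nat) (r : 'M[C]_d) : Prop :=
  exists v : 'cV[C]_d,
    \sum_i (v i 0)^*%C * v i 0 = 1 /\ r = v *m (map_mx (@conjc R) v)^T.

Definition is_hermitian (d : nat) (A : 'M[C]_d) : Prop :=
  forall i j, A i j = (A j i)^*%C.

End QDefs.

(* Main.v *)
Require Import Defs.
From mathcomp Require Import all_boot all_order all_algebra.
From mathcomp Require Import all_classical all_reals all_analysis.
From mathcomp Require Import complex.
From mathcomp Require Import ring lra zify.
Import Order.TTheory GRing.Theory Num.Theory.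
Local Open Scope ring_scope.

Set Implicit Arguments.
Unset Strict Implicit.
Unset Printing Implicit Defensive.

(** In the Pauli basis a circuit acts on the real coefficient vectors of Hermitian
    matrices through the product of the representation matrices of its layers, so
    f_C(x) = <alpha, M_l ... M_1 f_I(x)>.  Hoelder's inequality bounds each layer,
    |M v|_{p*} <= N^{max(1/p*, 1/q)} |M|_{p,q} |v|_{p*}  with N = 4^{n_i} rows,
    where the power of N comes from comparing the normalised q-norm of the row
    norms with their p*-norm.  This reduces the Rademacher complexity to
    E |sum_i eps_i f_I(x_i)|_{p*}, which is estimated coordinatewise by Khintchine's
    inequality  E |sum_i eps_i a_i|^r <= (k sum_i a_i^2)^{r/2}  for r <= 2k:
    k = floor(r) gives the constant sqrt r for r >= 2, and k = 1 serves r <= 2. *)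

(** * Finite l^p norms *)

Section LpNorms.
Variable R : realType.
Implicit Types (p q r s : R) (T : finType).

Lemma le_powR r x y : 0 <= r -> 0 <= x -> x <= y -> x `^ r <= y `^ r.
Proof.
move=> r0 x0 xy; apply: ge0_ler_powR => //; rewrite nnegrE //.
exact: le_trans xy.
Qed.

Lemma powRK r x : r != 0 -> 0 <= x -> (x `^ r^-1) `^ r = x.
Proof. by move=> r0 x0; rewrite -powRrM mulVf // powRr1. Qed.

Lemma powRVK r x : r != 0 -> 0 <= x -> (x `^ r) `^ r^-1 = x.
Proof. by move=> r0 x0; rewrite -powRrM mulfV // powRr1. Qed.

Lemma powRDpos x r s : 0 < x -> x `^ (r + s) = x `^ r * x `^ s.
Proof. by move=> x0; rewrite powRD //; apply/implyP => _; rewrite gt_eqF. Qed.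

Lemma sum_powR_ge0 T (a : T -> R) r : 0 <= \sum_t a t `^ r.
Proof. by apply: sumr_ge0 => *; exact: powR_ge0. Qed.

Lemma sum_powR_eq0 T (a : T -> R) p : 0 < p -> (forall t, 0 <= a t) ->
  \sum_t a t `^ p = 0 -> forall t, a t = 0.
Proof.
move=> p0 a0 /eqP; rewrite psumr_eq0; last by move=> *; exact: powR_ge0.
by move=> /allP h t; apply: powR_eq0_eq0 (eqP (h t _)); rewrite mem_index_enum.
Qed.

Lemma sum_powR_normalized T (a : T -> R) p : 0 < p -> (forall t, 0 <= a t) ->
  0 < \sum_t a t `^ p ->
  \sum_t (a t / (\sum_t a t `^ p) `^ p^-1) `^ p = 1.
Proof.
move=> p0 a0 sgt; under eq_bigr => t _.
  rewrite powRM ?invr_ge0 ?powR_ge0 // -powR_inv1 ?powR_ge0 //.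
  rewrite powRAC powRK ?gt_eqF ?ltW // powR_inv1 ?ltW //.
  over.
by rewrite -mulr_suml mulfV ?gt_eqF.
Qed.

(** Divide each family by its norm and apply Young's inequality termwise. If one of the norms is 0,
    that family vanishes and so does the left side. *)
Lemma holder_sum T (a b : T -> R) p q : 0 < p -> 0 < q -> p^-1 + q^-1 = 1 ->
  (forall t, 0 <= a t) -> (forall t, 0 <= b t) ->
  \sum_t a t * b t <= (\sum_t a t `^ p) `^ p^-1 * (\sum_t b t `^ q) `^ q^-1.
Proof.
move=> p0 q0 pq a0 b0.
have [A0|A0] := eqVneq (\sum_t a t `^ p) 0.
  rewrite big1 ?mulr_ge0 ?powR_ge0 // => t _.
  by rewrite (sum_powR_eq0 p0 a0 A0) mul0r.
have [B0|B0] := eqVneq (\sum_t b t `^ q) 0.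
  rewrite big1 ?mulr_ge0 ?powR_ge0 // => t _.
  by rewrite (sum_powR_eq0 q0 b0 B0) mulr0.
have Agt : 0 < \sum_t a t `^ p by rewrite lt_def A0 sum_powR_ge0.
have Bgt : 0 < \sum_t b t `^ q by rewrite lt_def B0 sum_powR_ge0.
have NA := sum_powR_normalized p0 a0 Agt; have NB := sum_powR_normalized q0 b0 Bgt.
move: NA NB; set A := (_ `^ p^-1); set B := (_ `^ q^-1) => NA NB.
have A1 : 0 < A by exact: powR_gt0.
have B1 : 0 < B by exact: powR_gt0.
clearbody A B.
suff: (\sum_t a t * b t) / (A * B) <= 1.
  by rewrite (ler_pdivrMr _ _ (mulr_gt0 A1 B1)) mul1r.
rewrite mulr_suml.
apply: (@le_trans _ _ (\sum_t ((a t / A) `^ p / p + (b t / B) `^ q / q))).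
  apply: ler_sum => t _; rewrite invfM mulrACA.
  have ha : 0 <= a t / A by rewrite divr_ge0 // ltW.
  have hb : 0 <= b t / B by rewrite divr_ge0 // ltW.
  exact: (conjugate_powR ha hb p0 q0 pq).
by rewrite big_split /= -!mulr_suml NA NB !mul1r pq.
Qed.

(** Hölder against the constant 1, with exponents r/s and r/(r-s). It serves both to compare l^s
    with l^r norms and as Jensen's inequality over sign patterns. *)
Lemma sum_powR_le_card T (a : T -> R) s r : 0 < s -> s <= r -> (forall t, 0 <= a t) ->
  \sum_t a t `^ s <= #|T|%:R `^ (1 - s / r) * (\sum_t a t `^ r) `^ (s / r).
Proof.
move=> s0 sr a0; have r0 : 0 < r by exact: lt_le_trans sr.
have [->|neq] := eqVneq s r.
  by rewrite divff ?gt_eqF // subrr powRr0 mul1r powRr1 // sumr_ge0 // => *; exact: powR_ge0.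
have slt : s < r by rewrite lt_neqAle neq.
have d0 : 0 < r - s by rewrite subr_gt0.
have := @holder_sum T (fun t => a t `^ s) (fun=> 1) (r / s) (r / (r - s)).
rewrite !divr_gt0 // !invf_div => /(_ erefl erefl) H.
apply: le_trans (le_trans (H _ _ _) _).
- by under eq_bigr do rewrite -[_ `^ _]mulr1.
- by rewrite -mulrDl addrC subrK divff // gt_eqF.
- by move=> t; exact: powR_ge0.
- by move=> t; exact: ler01.
rewrite mulrC; apply: ler_pM; [exact: powR_ge0|exact: powR_ge0| |].
  by rewrite powR1 sumr_const mulrBl divff // gt_eqF.
by under eq_bigr do rewrite -powRrM mulrCA divff ?gt_eqF // mulr1.
Qed.

Lemma lpnorm_ge0 T (p : \bar R) (v : T -> R) : 0 <= lpnorm p v.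
Proof.
case: p => [p||] /=; [exact: powR_ge0| |by []].
by elim/big_ind: _ => // x y x0 y0; rewrite le_max x0.
Qed.

Lemma lpnorm_powR T r (v : T -> R) : 0 < r ->
  (lpnorm r%:E v) `^ r = \sum_t `|v t| `^ r.
Proof.
by move=> r0; rewrite /= powRK ?gt_eqF // sum_powR_ge0.
Qed.

Lemma lpnorm_norm_le T (p : \bar R) (v : T -> R) t : (0 < p)%E -> `|v t| <= lpnorm p v.
Proof.
case: p => [p||] //=; last by move=> _; apply: (le_bigmax 0 (fun t => `|v t|)).
rewrite lte_fin => p0; rewrite -[leLHS](@powRVK p) ?gt_eqF //.
apply: le_powR; rewrite ?invr_ge0 ?powR_ge0 ?(ltW p0) //.
rewrite (bigD1 t) //= lerDl sumr_ge0 // => *; exact: powR_ge0.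
Qed.

Lemma lpnorm_antimono T (s r : \bar R) (v : T -> R) : (0 < s)%E -> (s <= r)%E ->
  lpnorm r v <= lpnorm s v.
Proof.
move=> s0 sr; case: r sr => [r||].
- case: s s0 => [s||]; [|by rewrite leye_eq|by rewrite ltNge leNye].
  rewrite !(lte_fin, lee_fin) => s0 sr.
  have r0 : 0 < r by exact: lt_le_trans sr.
  rewrite -[leRHS](@powRVK r) ?gt_eqF ?lpnorm_ge0 //.
  apply: le_powR; [by rewrite invr_ge0 ltW|exact: sum_powR_ge0|].
  have split_r x : x `^ r = x `^ s * x `^ (r - s).
    by rewrite -powRD ?subrKC // (gt_eqF r0).
  (* Termwise, |v_t|^r = |v_t|^s |v_t|^(r-s), and the second factor is at most the (r-s)-th power of
     the s-norm. *)
  rewrite [leRHS]split_r (lpnorm_powR _ s0) mulr_suml.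
  apply: ler_sum => t _; rewrite split_r; apply: ler_wpM2l; first exact: powR_ge0.
  by apply: le_powR; rewrite ?subr_ge0 //; apply: lpnorm_norm_le; rewrite lte_fin.
- by move=> _; apply: bigmax_le => [|t _]; [exact: lpnorm_ge0|exact: lpnorm_norm_le].
- by rewrite leeNy_eq => /eqP sE; move: s0; rewrite sE ltNge leNye.
Qed.

Lemma lpnorm_le_card T (s r : \bar R) (v : T -> R) : (0 < s)%E -> (s <= r)%E ->
  lpnorm s v <= #|T|%:R `^ (inv_ext s - inv_ext r) * lpnorm r v.
Proof.
case: s => [s||] // s0; last first.
  by rewrite leye_eq => /eqP ->; rewrite subrr powRr0 mul1r.
case: r => [r||] //=; rewrite ?lte_fin ?lee_fin in s0 *.
  move=> sr; have r0 : 0 < r by exact: lt_le_trans sr.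
  have S0 : 0 <= \sum_t `|v t| `^ r by exact: sum_powR_ge0.
  have := @sum_powR_le_card T (fun t => `|v t|) _ _ s0 sr (fun t => normr_ge0 _).
  move=> /(@le_powR s^-1 _ _ _ _) h; apply: le_trans (h _ _) _.
  - by rewrite invr_ge0 ltW.
  - exact: sum_powR_ge0.
  rewrite powRM ?powR_ge0 // -!powRrM mulrBl mul1r mulrAC divff ?gt_eqF // mul1r.
  exact: lexx.
move=> _; rewrite subr0 -[leRHS](@powRVK s) ?gt_eqF //; last first.
  by rewrite mulr_ge0 ?powR_ge0 // (lpnorm_ge0 +oo).
rewrite powRM ?powR_ge0 ?powRK ?gt_eqF // ?(@lpnorm_ge0 T +oo) //.
apply: le_powR; [by rewrite invr_ge0 ltW|exact: sum_powR_ge0|].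
rewrite mulr_natl -sumr_const; apply: ler_sum => t _.
by apply: le_powR; rewrite ?(ltW s0) // (@lpnorm_norm_le T +oo).
Qed.

Lemma lpnorm_holder T p (a b : T -> R) : 1 <= p ->
  `|\sum_t a t * b t| <= lpnorm p%:E a * lpnorm (hconj p) b.
Proof.
move=> p1; apply: le_trans (ler_norm_sum _ _ _) _.
under eq_bigr do rewrite normrM.
rewrite /hconj; case: eqVneq => [->|pn1].
  rewrite [lpnorm 1%:E a]/= invr1 powRr1; last exact: sum_powR_ge0.
  rewrite mulr_suml; apply: ler_sum => t _; rewrite powRr1 //.
  by rewrite ler_wpM2l // (@lpnorm_norm_le T +oo).
have pgt : 1 < p by rewrite lt_neqAle eq_sym pn1.
have p0 : 0 < p by exact: lt_trans pgt.
rewrite /=; apply: holder_sum => //; first by rewrite divr_gt0 // subr_gt0.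
by rewrite invf_div mulrBl divff ?gt_eqF // mul1r subrKC.
Qed.

Lemma inv_ext_hconj p : 1 <= p -> inv_ext (hconj p) = 1 - p^-1.
Proof.
rewrite /hconj; case: eqVneq => [-> _|pn1 p1] /=; first by rewrite invr1 subrr.
by rewrite invf_div mulrBl mul1r divff // gt_eqF // (lt_le_trans ltr01).
Qed.

Lemma hconj_ge1 p : 1 <= p -> (1 <= hconj p)%E.
Proof.
rewrite /hconj; case: eqVneq => [-> _|pn1 p1] //=; first by rewrite leey.
have pgt : 1 < p by rewrite lt_neqAle eq_sym pn1.
by rewrite lee_fin ler_pdivlMr ?subr_gt0 // mul1r lerBlDr lerDl ler01.
Qed.

(** Separates the normalisation from a plain q-norm of the row norms, so that norm comparisons
    apply; q = oo fits the same formula because [inv_ext] is 0 there. *)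
Lemma groupnormE (T1 T2 : finType) p (q : \bar R) (M : T1 -> T2 -> R) : (0 < q)%E ->
  groupnorm p q M =
  #|T1|%:R `^ (- inv_ext q) * lpnorm q (fun i => lpnorm p%:E (M i)).
Proof.
pose g i := lpnorm p%:E (M i); have g0 i : 0 <= g i by exact: lpnorm_ge0.
case: q => [q||] q0; last by rewrite ltNge leNye in q0.
  have -> : lpnorm q%:E g = (\sum_i g i `^ q) `^ q^-1.
    by congr (_ `^ _); apply: eq_bigr => i _; rewrite ger0_norm.
  rewrite /groupnorm -/(g _) [inv_ext _]/= powRM ?invr_ge0 ?sum_powR_ge0 //.
  by rewrite powRN -[in LHS]powR_inv1 // -powRrM mulN1r powRN.
rewrite [inv_ext _]/= oppr0 powRr0 mul1r.
by apply: eq_bigr => i _; rewrite ger0_norm // lpnorm_ge0.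
Qed.

(** With N rows, passing from s to q costs N^(1/s - 1/q) when s <= q and nothing when q <= s.
    Undoing the normalisation adds N^(1/q), so the total exponent is 1/s or 1/q, whichever is
    larger. *)
Lemma lpnorm_le_groupnorm (T1 T2 : finType) p (q s : \bar R) (M : T1 -> T2 -> R) :
  (0 < #|T1|)%N -> (0 < q)%E -> (0 < s)%E ->
  lpnorm s (fun i => lpnorm p%:E (M i)) <=
  #|T1|%:R `^ (Num.max (inv_ext s) (inv_ext q)) * groupnorm p q M.
Proof.
move=> T0 q0 s0; set g := fun i => _.
rewrite groupnormE // mulrA -powRDpos ?ltr0n //.
have [sq|/ltW qs] := leP s q.
  apply: le_trans (lpnorm_le_card _ s0 sq) _; rewrite ler_wpM2r ?lpnorm_ge0 //.
  by rewrite ler_powR ?ler1n // lerD2r le_max lexx.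
apply: le_trans (lpnorm_antimono _ q0 qs) _; rewrite -[leLHS]mul1r ler_wpM2r ?lpnorm_ge0 //.
rewrite -[leLHS](@powRr0 _ #|T1|%:R) ler_powR ?ler1n //.
by rewrite subr_ge0 le_max lexx orbT.
Qed.

Lemma lpnorm_mulmx_le (T1 T2 : finType) p (q : \bar R) (M : T1 -> T2 -> R) (v : T2 -> R) :
  (0 < #|T1|)%N -> 1 <= p -> (0 < q)%E ->
  lpnorm (hconj p) (fun i => \sum_j M i j * v j) <=
  #|T1|%:R `^ (Num.max (1 - p^-1) (inv_ext q)) * groupnorm p q M * lpnorm (hconj p) v.
Proof.
move=> T0 p1 q0.
have s0 : (0 < hconj p)%E by apply: lt_le_trans (hconj_ge1 p1); rewrite lte_fin.
have h := lpnorm_le_groupnorm p M T0 q0 s0; rewrite inv_ext_hconj // in h.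
apply: le_trans (ler_wpM2r (lpnorm_ge0 _ _) h).
have row i := lpnorm_holder (M i) v p1.
(* The norm of v becomes an opaque constant, so that the case split on p* touches only the norms
   over the rows. *)
move: row s0 (lpnorm_ge0 (hconj p) v); move: (lpnorm _ v) => V.
case: (hconj p) => [s||] //= row; rewrite ?lte_fin => s0 V0.
  have sn : s != 0 by rewrite gt_eqF.
  rewrite -[leRHS](@powRVK s) //; last by rewrite mulr_ge0 // powR_ge0.
  rewrite powRM ?powR_ge0 // powRK //; last exact: sum_powR_ge0.
  apply: le_powR; [by rewrite invr_ge0 ltW|exact: sum_powR_ge0|].
  rewrite mulr_suml; apply: ler_sum => i _; rewrite -powRM //.
  apply: le_powR; rewrite ?(ltW s0) //; apply: le_trans (row i) _.
  by rewrite ler_wpM2r // ler_norm.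
apply: bigmax_le => [|i _]; first by rewrite mulr_ge0 // (@lpnorm_ge0 _ +oo).
apply: le_trans (row i) _; rewrite ler_wpM2r //.
by apply: le_trans (ler_norm _) _; apply: (@lpnorm_norm_le _ +oo).
Qed.

End LpNorms.

(** * Khintchine's inequality *)

Section Khintchine.
Variable R : realType.
Implicit Types x y r p B D : R.

(** Divided powers: they turn the binomial theorem into a convolution without coefficients, as for
    the Taylor coefficients of exp. *)
Definition divpow x n : R := x ^+ n / n`!%:R.

Lemma divpow_ge0 x n : 0 <= x -> 0 <= divpow x n.
Proof. by move=> x0; rewrite divr_ge0 ?exprn_ge0 ?ler0n. Qed.

Lemma divpowD x y n :
  divpow (x + y) n = \sum_(i < n.+1) divpow x (n - i) * divpow y i.
Proof.
have factn0 k : k`!%:R != 0 :> R by rewrite pnatr_eq0 -lt0n fact_gt0.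
rewrite /divpow exprDn mulr_suml; apply: eq_bigr => i _.
have /(congr1 (fun k => k%:R : R)) := bin_fact (ltn_ord i : (i <= n)%N).
rewrite !natrM => <-; rewrite -mulr_natr.
have b0 : 'C(n, i)%:R != 0 :> R by rewrite pnatr_eq0 -lt0n bin_gt0 -ltnS.
by field; rewrite !factn0 b0.
Qed.

Lemma sum_even_terms (G : nat -> R) k : (forall j, G (2 * j).+1 = 0) ->
  \sum_(i < (2 * k).+1) G i = \sum_(j < k.+1) G (2 * j)%N.
Proof.
move=> G0; elim: k => [|k IH]; first by rewrite muln0 !big_ord1.
by rewrite mulnS !addSn add0n 2!big_ord_recr /= IH G0 addr0 [RHS]big_ord_recr /= mulnS.
Qed.

Lemma divpow_even_symm x y k :
  divpow (x + y) (2 * k) + divpow (x - y) (2 * k) =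
  2 * \sum_(j < k.+1) divpow x (2 * (k - j)) * divpow y (2 * j).
Proof.
rewrite !divpowD -big_split /=.
pose G i := divpow x (2 * k - i) * divpow y i + divpow x (2 * k - i) * divpow (- y) i.
rewrite (@sum_even_terms G) => [|j]; last first.
  by rewrite /G /divpow exprNn [(-1) ^+ _]exprS exprM sqrrN !expr1n mulr1 mulN1r mulNr mulrN subrr.
rewrite mulr_sumr; apply: eq_bigr => j _.
rewrite /G -mulnBr /divpow exprNn [(-1) ^+ _]exprM sqrrN !expr1n mul1r.
by rewrite -mulr2n mulr_natl.
Qed.

Lemma exp2_fact_le k : (2 ^ k * k`! <= (2 * k)`!)%N.
Proof.
elim: k => // k IH; rewrite mulnS !addSn add0n !factS expnS.
have -> : (2 * 2 ^ k * (k.+1 * k`!) = (2 * k).+2 * (2 ^ k * k`!))%N by nia.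
by rewrite leq_mul2l /=; apply: leq_trans IH _; rewrite leq_pmull.
Qed.

(** Bernoulli's inequality without division; for n + 1 = k it yields 2 k^k <= (k+1)^k. *)
Lemma bernoulli_nat k n : (k ^ n.+1 + n.+1 * k ^ n <= k.+1 ^ n.+1)%N.
Proof.
elim: n => [|n IH]; first by rewrite !expn1 expn0 addn1.
rewrite [(k.+1 ^ _)%N]expnS; apply: leq_trans (leq_mul (leqnn k.+1) IH).
by rewrite !expnS; nia.
Qed.

(** In other terms (2k-1)!! <= k^k, the source of the constant in Khintchine's inequality. The
    inductive step bounds 2k+1 by 2k+2 and absorbs the extra 2 by Bernoulli. *)
Lemma fact_double_le k : ((2 * k)`! <= 2 ^ k * k`! * k ^ k)%N.
Proof.
(* The step needs 2 k^k <= (k+1)^k, which fails at k = 0; the values 0 and 1 are therefore checked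
   directly. *)
elim: k => [|[|k']] // IH; set k := k'.+1 in IH *.
have bern : (2 * k ^ k <= k.+1 ^ k)%N.
  by apply: leq_trans (bernoulli_nat k k'); rewrite -expnS mul2n addnn.
clearbody k; rewrite mulnS !addSn add0n !factS.
have -> : (2 ^ k.+1 * (k.+1 * k`!) * k.+1 ^ k.+1 =
           2 * k.+1 * k.+1 * (2 ^ k * k`! * k.+1 ^ k))%N by rewrite !expnS; ring.
have step : ((2 * k).+2 * ((2 * k).+1 * (2 ^ k * k`! * k ^ k)) <=
             2 * k.+1 * k.+1 * (2 ^ k * k`! * (2 * k ^ k)))%N.
  by move: (2 ^ k * k`!)%N (k ^ k)%N => x y; nia.
apply: leq_trans (leq_trans step _); first by rewrite !leq_mul2l IH !orbT.
by rewrite !leq_mul2l bern !orbT.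
Qed.

(** The coefficientwise form of cosh y <= exp(y^2 / 2). *)
Lemma divpow_double_le y j : divpow y (2 * j) <= divpow (y ^+ 2 / 2) j.
Proof.
rewrite /divpow expr_div_n -exprM -mulrA; apply: ler_wpM2l.
  by rewrite exprM exprn_ge0 ?sqr_ge0.
rewrite -invfM lef_pV2 ?posrE ?mulr_gt0 ?exprn_gt0 ?ltr0n ?fact_gt0 //.
by rewrite -natrX -natrM ler_nat exp2_fact_le.
Qed.

(** * Moments of scalar Rademacher sums *)

Variable I : finType.
Implicit Types (e : {ffun I -> bool}) (a : I -> R).

Definition rsign (b : bool) : R := if b then -1 else 1.

Definition flip j e : {ffun I -> bool} := [ffun i => if i == j then ~~ e i else e i].

Lemma flipK j : involutive (flip j).
Proof. by move=> e; apply/ffunP => i; rewrite !ffunE; case: eqP => // _; rewrite negbK. Qed.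

Lemma sum_flip j (F : {ffun I -> bool} -> R) : \sum_(e : {ffun I -> bool}) F e = \sum_(e : {ffun I -> bool}) F (flip j e).
Proof. by rewrite (reindex_inj (inv_inj (flipK j))). Qed.

Local Notation card := (#|{ffun I -> bool}|%:R : R).

(* Averaging over the sign of one coordinate at a time kills the odd part of the moment. *)
Lemma sum_divpow_rsign (s : seq I) a k : uniq s ->
  \sum_(e : {ffun I -> bool}) divpow (\sum_(i <- s) rsign (e i) * a i) (2 * k) <=
  card * divpow ((\sum_(i <- s) a i ^+ 2) / 2) k.
Proof.
elim: s k => [|j s IH] k /=.
  move=> _; under eq_bigr do rewrite big_nil.
  rewrite big_nil mul0r sumr_const -[leLHS]mulr_natl ler_wpM2l ?ler0n //.
  case: k => [|k]; first by rewrite muln0.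
  by rewrite /divpow mulnS !exprS !mul0r.
move=> /andP[js us].
have flip_s e : \sum_(i <- s) rsign (flip j e i) * a i = \sum_(i <- s) rsign (e i) * a i.
  apply: eq_big_seq => i is_; rewrite ffunE; case: eqP => // ij.
  by rewrite -ij is_ in js.
have flip_j e : rsign (flip j e j) = - rsign (e j).
  by rewrite ffunE eqxx /rsign; case: (e j); rewrite ?opprK.
have sqr_rsign e : (rsign (e j) * a j) ^+ 2 = a j ^+ 2.
  by rewrite exprMn /rsign; case: (e j); rewrite ?sqrrN expr1n mul1r.
rewrite -(ler_pM2l (ltr0n R 2)) [leLHS](mulr_natl _ 2) mulr2n [X in _ + X <= _](sum_flip j) -big_split /=.
apply: (@le_trans _ _ (\sum_(e : {ffun I -> bool}) 2 * \sum_(i < k.+1)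
   divpow (\sum_(i <- s) rsign (e i) * a i) (2 * (k - i)) * divpow (a j ^+ 2 / 2) i)).
  apply: ler_sum => e _; rewrite !big_cons flip_s flip_j mulNr.
  rewrite ![_ + \sum_(i <- s) _]addrC divpow_even_symm.
  rewrite ler_wpM2l //; apply: ler_sum => i _; rewrite ler_wpM2l //.
    by rewrite /divpow exprM divr_ge0 ?ler0n // exprn_ge0 // sqr_ge0.
  by apply: le_trans (divpow_double_le _ _) _; rewrite sqr_rsign.
(* For each i the induction hypothesis bounds the moment of the tail at order k - i; the convolution
   formula then reassembles the divided power of the full sum of squares. *)
rewrite -mulr_sumr ler_wpM2l // exchange_big big_cons addrC mulrDl divpowD mulr_sumr /=.
apply: ler_sum => i _; rewrite -mulr_suml mulrA ler_wpM2r ?IH //.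
by rewrite divpow_ge0 // divr_ge0 ?sqr_ge0.
Qed.

Lemma sum_even_moment_rsign a k :
  \sum_(e : {ffun I -> bool}) (\sum_i rsign (e i) * a i) ^+ (2 * k) <= card * (k%:R * \sum_i a i ^+ 2) ^+ k.
Proof.
have f0 : 0 < (2 * k)`!%:R :> R by rewrite ltr0n fact_gt0.
rewrite -(ler_pM2r (_ : 0 < (2 * k)`!%:R^-1)) ?invr_gt0 // mulr_suml.
apply: le_trans (sum_divpow_rsign a k (index_enum_uniq I)) _.
rewrite -[leRHS]mulrA ler_wpM2l ?ler0n // /divpow; set Q := \sum_(i <- _) _.
rewrite expr_div_n [(k%:R * Q) ^+ k]exprMn [_ * Q ^+ k]mulrC -!mulrA; apply: ler_wpM2l.
  by rewrite exprn_ge0 // sumr_ge0 // => *; rewrite sqr_ge0.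
rewrite ler_pdivlMr // mulrC -invfM ler_pdivrMr; last first.
  by rewrite mulr_gt0 ?exprn_gt0 ?ltr0n ?fact_gt0.
by rewrite -!natrX -!natrM ler_nat [leqRHS]mulnC fact_double_le.
Qed.

(** The r-th moment is dominated through the 2k-th one by the power mean inequality over sign
    patterns; the powers of their number recombine to exponent 1. *)
Lemma khintchine a k r : (0 < k)%N -> 0 < r -> r <= (2 * k)%:R ->
  \sum_(e : {ffun I -> bool}) `|\sum_i rsign (e i) * a i| `^ r <=
  card * (k%:R * \sum_i a i ^+ 2) `^ (r / 2).
Proof.
move=> k0 r0 rk; set W := k%:R * _.
have W0 : 0 <= W by rewrite mulr_ge0 ?ler0n // sumr_ge0 // => *; rewrite sqr_ge0.
have c0 : 0 < card by rewrite ltr0n; apply/card_gt0P; exists [ffun=> true].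
have k20 : (2 * k)%:R != 0 :> R by rewrite pnatr_eq0 muln_eq0 /= -lt0n.
pose A (e : {ffun I -> bool}) : R := `|\sum_i rsign (e i) * a i|.
have A0 e : 0 <= A e by exact: normr_ge0.
apply: le_trans (sum_powR_le_card r0 rk A0) _.
apply: (@le_trans _ _ (card `^ (1 - r / (2 * k)%:R) * (card * W ^+ k) `^ (r / (2 * k)%:R))).
  apply: ler_wpM2l; first exact: powR_ge0.
  apply: le_powR; [by rewrite divr_ge0 ?ler0n // ltW|exact: sum_powR_ge0|].
  apply: le_trans (sum_even_moment_rsign a k); apply: ler_sum => e _.
  by rewrite powR_mulrn // /A -normrX exprM ger0_norm // exprn_ge0 ?sqr_ge0.
rewrite powRM ?exprn_ge0 ?ler0n // mulrA -powRDpos // subrK powRr1 ?(ltW c0) //.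
rewrite -powR_mulrn // -powRrM.
suff -> : k%:R * (r / (2 * k)%:R) = r / 2 by exact: lexx.
have kn : k%:R != 0 :> R by rewrite pnatr_eq0 -lt0n.
by rewrite natrM; field.
Qed.

(** Comparison of l^2 with l^r. The lost power of |I| is what later produces the square root of the
    sample size. *)
Lemma sum_sqr_powR_ge2 a r : 2 <= r ->
  (\sum_i a i ^+ 2) `^ (r / 2) <= #|I|%:R `^ (r / 2 - 1) * \sum_i `|a i| `^ r.
Proof.
move=> r2; have r0 : 0 < r by exact: lt_le_trans r2.
have h := @sum_powR_le_card R I (fun i => `|a i|) 2 r (ltr0Sn R 1) r2 (fun i => normr_ge0 _).
have E : \sum_i a i ^+ 2 = \sum_i `|a i| `^ 2.
  by apply: eq_bigr => i _; rewrite powR_mulrn // real_normK // num_real.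
rewrite E; apply: (le_trans (le_powR _ _ h)); first by rewrite divr_ge0 // ltW.
  exact: sum_powR_ge0.
rewrite powRM ?powR_ge0 // -!powRrM.
have -> : (1 - 2 / r) * (r / 2) = r / 2 - 1 by field; rewrite gt_eqF.
have -> : 2 / r * (r / 2) = 1 by field; rewrite gt_eqF.
by rewrite powRr1 // sum_powR_ge0.
Qed.

Lemma sum_sqr_powR_le2 a r : 0 < r -> r <= 2 ->
  (\sum_i a i ^+ 2) `^ (r / 2) <= \sum_i `|a i| `^ r.
Proof.
move=> r0 r2.
have h : lpnorm 2%:E a <= lpnorm r%:E a by apply: lpnorm_antimono; rewrite ?lte_fin ?lee_fin.
have E : \sum_i a i ^+ 2 = \sum_i `|a i| `^ 2.
  by apply: eq_bigr => i _; rewrite powR_mulrn // real_normK // num_real.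
rewrite E -(lpnorm_powR _ r0) mulrC powRrM.
by apply: (le_powR _ _ h); [exact: ltW|exact: lpnorm_ge0].
Qed.

(** * Rademacher sums of vectors in l^r *)

Variable T : finType.
Implicit Types v : I -> T -> R.

(** Jensen moves the average inside the r-th power, where the norm splits into coordinates and the
    scalar moment bound with constant D applies to each of them. *)
Lemma sum_lpnorm_rsign v r B D : 1 <= r -> 0 <= B -> 0 <= D ->
  (forall i, lpnorm r%:E (v i) <= B) ->
  (forall a, \sum_(e : {ffun I -> bool}) `|\sum_i rsign (e i) * a i| `^ r <= card * (D * \sum_i `|a i| `^ r)) ->
  \sum_(e : {ffun I -> bool}) lpnorm r%:E (fun t => \sum_i rsign (e i) * v i t) <=
  card * ((D * #|I|%:R) `^ r^-1 * B).
Proof.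
move=> r1 B0 D0 vB moment; have r0 : 0 < r by exact: lt_le_trans r1.
have c0 : 0 < card by rewrite ltr0n; apply/card_gt0P; exists [ffun=> true].
pose A e := lpnorm r%:E (fun t => \sum_i rsign (e i) * v i t).
have A0 e : 0 <= A e by exact: lpnorm_ge0.
have h := sum_powR_le_card ltr01 r1 A0.
have -> : \sum_(e : {ffun I -> bool}) A e = \sum_(e : {ffun I -> bool}) A e `^ 1 by apply: eq_bigr => e _; rewrite powRr1.
apply: (le_trans h).
have Ar : \sum_(e : {ffun I -> bool}) A e `^ r <= card * (D * #|I|%:R * B `^ r).
  under eq_bigr do rewrite /A lpnorm_powR //.
  rewrite exchange_big /=.
  apply: (@le_trans _ _ (\sum_t card * (D * \sum_i `|v i t| `^ r))).
    by apply: ler_sum => t _; exact: moment.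
  rewrite -mulr_sumr ler_wpM2l ?(ltW c0) // -mulr_sumr -mulrA ler_wpM2l // exchange_big /=.
  rewrite mulr_natl -sumr_const; apply: ler_sum => i _; rewrite -lpnorm_powR //.
  by apply: le_powR; rewrite ?lpnorm_ge0 // ltW.
rewrite div1r.
apply: (@le_trans _ _ (card `^ (1 - r^-1) * (card * (D * #|I|%:R * B `^ r)) `^ r^-1)).
  apply: ler_wpM2l; first exact: powR_ge0.
  by apply: le_powR; [rewrite invr_ge0 ltW|exact: sum_powR_ge0|].
have DI : 0 <= D * #|I|%:R by rewrite mulr_ge0 ?ler0n.
rewrite powRM ?(ltW c0) ?mulr_ge0 ?powR_ge0 //.
rewrite mulrA -powRDpos // subrK powRr1 ?(ltW c0) //.
by rewrite powRM ?powR_ge0 // powRVK // gt_eqF.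
Qed.

Lemma sum_lpnorm_rsign_ge2 v r B : (0 < #|I|)%N -> 2 <= r -> 0 <= B ->
  (forall i, lpnorm r%:E (v i) <= B) ->
  \sum_(e : {ffun I -> bool}) lpnorm r%:E (fun t => \sum_i rsign (e i) * v i t) <=
  card * (Num.sqrt r * Num.sqrt #|I|%:R * B).
Proof.
move=> I0 r2 B0 vB; have r0 : 0 < r by exact: lt_le_trans r2.
have Ipos : 0 < #|I|%:R :> R by rewrite ltr0n.
have r1 : 1 <= r by apply: le_trans r2; rewrite ler1n.
have D0 : 0 <= r `^ (r / 2) * #|I|%:R `^ (r / 2 - 1) by rewrite mulr_ge0 ?powR_ge0.
(* The constant D combines the Khintchine factor r^(r/2) with the loss |I|^(r/2 - 1) of passing from
   l^2 to l^r. *)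
have DE : (r `^ (r / 2) * #|I|%:R `^ (r / 2 - 1) * #|I|%:R) `^ r^-1 =
    Num.sqrt r * Num.sqrt #|I|%:R.
  rewrite -mulrA -[X in _ * (_ * X)]powRr1 ?ler0n // -powRDpos // subrK.
  rewrite -powRM ?(ltW r0) ?ler0n // -powRrM.
  have -> : r / 2 * r^-1 = 2^-1 by field; rewrite gt_eqF.
  by rewrite powR12_sqrt ?mulr_ge0 ?ler0n ?(ltW r0) // sqrtrM // ltW.
rewrite -DE; apply: sum_lpnorm_rsign => // a.
set k := Num.truncn r.
have /andP[kr rk] := truncn_itv (ltW r0); rewrite -/k in kr rk.
have k0 : (0 < k)%N by rewrite /k truncn_gt0.
(* r < k + 1 <= 2k since k >= 1. *)
have rk2 : r <= (2 * k)%:R.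
  by apply: (le_trans (ltW rk)); rewrite ler_nat mul2n -addnn -addn1 leq_add2l.
apply: le_trans (khintchine a k0 r0 rk2) _; apply: ler_wpM2l; first exact: ler0n.
have S0 : 0 <= \sum_i a i ^+ 2 by rewrite sumr_ge0 // => *; rewrite sqr_ge0.
rewrite powRM ?ler0n // -mulrA; apply: ler_pM; rewrite ?powR_ge0 //.
  by apply: le_powR; rewrite ?ler0n // divr_ge0 // ltW.
exact: sum_sqr_powR_ge2.
Qed.

Lemma sum_lpnorm_rsign_le2 v r B : 1 <= r -> r <= 2 -> 0 <= B ->
  (forall i, lpnorm r%:E (v i) <= B) ->
  \sum_(e : {ffun I -> bool}) lpnorm r%:E (fun t => \sum_i rsign (e i) * v i t) <=
  card * (#|I|%:R `^ r^-1 * B).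
Proof.
move=> r1 r2 B0 vB; have r0 : 0 < r by exact: lt_le_trans r1.
rewrite -[#|I|%:R]mul1r; apply: sum_lpnorm_rsign => // a; rewrite mul1r.
have := @khintchine a 1%N r isT r0; rewrite muln1 mul1r => /(_ r2) h.
apply: (le_trans h); rewrite ler_wpM2l ?ler0n //; exact: sum_sqr_powR_le2.
Qed.

(* For large p* pass to the exponent 4n: it costs the factor (4^n)^(1/(4n)) = sqrt 2. *)
Lemma sum_lpnorm_hconj_rsign v p B n : (0 < #|I|)%N -> (0 < n)%N -> #|T| = (4 ^ n)%N ->
  1 <= p -> p <= 2 -> 0 <= B -> (forall i, lpnorm (hconj p) (v i) <= B) ->
  \sum_(e : {ffun I -> bool}) lpnorm (hconj p) (fun t => \sum_i rsign (e i) * v i t) <=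
  card * (Num.sqrt (minconj p (8 * n%:R)) * Num.sqrt #|I|%:R * B).
Proof.
move=> I0 n0 Tn p1 p2 B0.
have n1 : 1 <= n%:R :> R by rewrite ler1n.
have npos : 0 < n%:R :> R by exact: lt_le_trans n1.
have large (s : \bar R) : ((4 * n%:R)%:E <= s)%E -> (forall i, lpnorm s (v i) <= B) ->
    \sum_(e : {ffun I -> bool}) lpnorm s (fun t => \sum_i rsign (e i) * v i t) <=
    card * (Num.sqrt (8 * n%:R) * Num.sqrt #|I|%:R * B).
  move=> ns vB; set r : R := 4 * n%:R in ns *.
  have r0 : 0 < r by rewrite mulr_gt0.
  have s0 : (0 < s)%E by apply: lt_le_trans ns; rewrite lte_fin.
  have rE : (0 < r%:E)%E by rewrite lte_fin.
  apply: (@le_trans _ _ (\sum_(e : {ffun I -> bool}) lpnorm r%:E (fun t => \sum_i rsign (e i) * v i t))).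
    by apply: ler_sum => e _; exact: lpnorm_antimono.
  have r2 : 2 <= r by rewrite /r; lra.
  have vB' i : lpnorm r%:E (v i) <= Num.sqrt 2 * B.
    apply: (le_trans (lpnorm_le_card (v i) rE ns)); apply: ler_pM.
    - exact: powR_ge0.
    - exact: lpnorm_ge0.
    - have -> : Num.sqrt 2 = #|T|%:R `^ r^-1 :> R.
        rewrite Tn natrX -powR_mulrn // -powRrM -powR12_sqrt //.
        have -> : 4 = 2 `^ 2 :> R by rewrite (@powR_mulrn _ _ 2) // -natrX.
        by rewrite -powRrM; congr (_ `^ _); rewrite /r; field; rewrite gt_eqF.
      rewrite ler_powR ?Tn ?ler1n ?expn_gt0 // gerDl oppr_le0.
      by case: s s0 {ns vB} => [s||] //=; rewrite lte_fin invr_ge0 => /ltW.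
    exact: vB.
  apply: (le_trans (sum_lpnorm_rsign_ge2 I0 r2 _ vB')); first by rewrite mulr_ge0 ?sqrtr_ge0.
  (* The constant 8n is the exponent 4n times the square of the loss sqrt 2. *)
  have -> : Num.sqrt (8 * n%:R) = Num.sqrt r * Num.sqrt 2 :> R.
    by rewrite -sqrtrM ?(ltW r0) //; congr Num.sqrt; rewrite /r; ring.
  by rewrite le_eqVlt; apply/orP; left; apply/eqP; ring.
rewrite /minconj; case E : (hconj p) => [s||] vB.
- rewrite /Num.min; case: ifP => [_|/negbT]; last first.
    by rewrite -leNgt => ns; apply: large vB; rewrite lee_fin; lra.
  (* Here p* < 8n, and p <= 2 gives p* >= 2, so p* itself serves as the exponent. *)
  apply: sum_lpnorm_rsign_ge2 => //.
  move: E; rewrite /hconj; case: eqVneq => // pn1 [<-].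
  have pgt : 1 < p by rewrite lt_neqAle eq_sym pn1.
  by rewrite ler_pdivlMr ?subr_gt0 //; lra.
- by apply: large vB; rewrite leey.
- by move: E; rewrite /hconj; case: ifP.
Qed.

End Khintchine.

(** * Pauli coefficients of circuit states *)

Section PauliVectors.
Variable R : realType.
Local Notation C := R[i].
Local Notation Re := complex.Re.
Local Notation Im := complex.Im.

Lemma Re_realM (c : R) (x : C) : Re (c%:C%C * x) = c * Re x.
Proof. by case: x => a b /=; rewrite mul0r subr0. Qed.

(** Nonnegativity in the order of complex numbers includes being real, so test vectors supported on
    s and t determine the symmetry by polarisation. *)
Lemma psdf_hermitian (T : finType) (A : T -> T -> C) s t :
  psdf A -> A s t = (A t s)^*%C.
Proof.
move=> psd; pose v (a b : C) u := a * (u == s)%:R + b * (u == t)%:R.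
have vE a b (f : T -> C) : \sum_u v a b u * f u = a * f s + b * f t.
  under eq_bigr do rewrite /v mulrDl.
  rewrite big_split /= (bigD1 s) //= [\sum_i b * _ * _](bigD1 t) //= !eqxx !mulr1.
  rewrite big1 ?addr0 => [|i /negbTE ->]; last by rewrite mulr0 mul0r.
  by rewrite big1 ?addr0 // => i /negbTE ->; rewrite mulr0 mul0r.
have vJ a b u : (v a b u)^*%C = v a^*%C b^*%C u by rewrite /v rmorphD !rmorphM /= !conjc_nat.
have Q a b : 0 <= a^*%C * (a * A s s + b * A s t) + b^*%C * (a * A t s + b * A t t).
  have := psd (v a b); under eq_bigr => u _.
    under eq_bigr do rewrite -mulrA [A _ _ * _]mulrC.
    rewrite -mulr_sumr vJ vE; over.
  by rewrite vE.
(* The first two make the diagonal real, the third makes the imaginary parts opposite, the fourth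
   makes the real parts equal. *)
move: (Q 1 0) (Q 0 1) (Q 1 1) (Q 1 'i%C).
rewrite !lecE; case: (A s s) => a1 a2; case: (A t t) => d1 d2.
case: (A s t) => b1 b2; case: (A t s) => c1 c2 /=.
move=> /andP[/eqP h1 _] /andP[/eqP h2 _] /andP[/eqP h3 _] /andP[/eqP h4 _].
by apply/eqP; rewrite eq_complex /=; apply/andP; split; apply/eqP; lra.
Qed.

(** The sum of P (x) P over the Paulis is twice the swap operator. Completeness gives the Pauli
    expansion directly, without orthogonality and a dimension count. *)
Lemma pauli1_completeness (a b c d : bool) :
  \sum_(s < 4) pauli1 R s a b * pauli1 R s c d = if (a == d) && (b == c) then 2 else 0.
Proof.
rewrite 4!big_ord_recr big_ord0 /= /pauli1 /=.
by case: a; case: b; case: c; case: d => /=; apply/eqP; rewrite eq_complex /=;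
   apply/andP; split; apply/eqP; ring.
Qed.

Lemma pauli1_hermitian s (a b : bool) : (pauli1 R s a b)^*%C = pauli1 R s b a.
Proof.
rewrite /pauli1; case: (val s) => [|[|[|k]]]; case: a; case: b => /=;
  by apply/eqP; rewrite eq_complex /= ?oppr0 ?opprK !eqxx.
Qed.

Lemma qbit_inj n i j : (i < 2 ^ n)%N -> (j < 2 ^ n)%N ->
  (forall k : 'I_n, qbit k i = qbit k j) -> i = j.
Proof.
elim: n i j => [|n IH] i j; first by rewrite expn0 !ltnS !leqn0 => /eqP -> /eqP ->.
rewrite expnS => hi hj h.
have h0 := h ord0; rewrite /qbit !divn1 in h0.
have e2 : (i %/ 2 = j %/ 2)%N.
  apply: IH; rewrite ?ltn_divLR // 1?mulnC // => k.
  by have := h (lift ord0 k); rewrite /qbit /= expnS -!divnMA.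
by rewrite -(odd_double_half i) -(odd_double_half j) h0 -!divn2 e2.
Qed.

(** The sum over z factors into one sum per qubit; if the indices do not match, they differ in some
    bit, whose factor is 0. *)
Lemma pauli_completeness n (i j k l : 'I_(2 ^ n)) :
  \sum_z pauli R z i j * pauli R z k l = if (i == l) && (j == k) then 2 ^+ n else 0.
Proof.
under eq_bigr do rewrite !mxE -big_split /=.
rewrite -(bigA_distr_bigA (fun (b : 'I_n) s =>
  pauli1 R s (qbit b i) (qbit b j) * pauli1 R s (qbit b k) (qbit b l))).
under eq_bigr do rewrite pauli1_completeness.
case: ifP => [/andP[/eqP -> /eqP ->]|].
  under eq_bigr do rewrite !eqxx.
  by rewrite prodr_const card_ord.
move=> ne; have [b hb] : exists b : 'I_n, ~~ ((qbit b i == qbit b l) && (qbit b j == qbit b k)).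
  apply/existsP; rewrite -negb_forall; apply/negP => /forallP h.
  move/negP: ne; apply; apply/andP; split; apply/eqP/val_inj; apply: (@qbit_inj n);
  rewrite ?ltn_ord // => b; by case/andP: (h b) => /eqP ? /eqP ?.
by rewrite (bigD1 b) //= (negbTE hb) mul0r.
Qed.

(** For an input state this is the vector f_I; taking the real part loses nothing when X is
    Hermitian. *)
Definition pvec n (X : 'M[C]_(2 ^ n)) (z : pidx n) : R :=
  (2%:R ^+ n)^-1 * Re (\tr (pauli R z *m X)).

Lemma trace_pauli_hermitian n (X : 'M[C]_(2 ^ n)) z : is_hermitian X ->
  \tr (pauli R z *m X) = (Re (\tr (pauli R z *m X)))%:C%C.
Proof.
move=> hX; suff : (\tr (pauli R z *m X))^*%C = \tr (pauli R z *m X).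
  by case: (\tr _) => a b [] h; apply/eqP; rewrite eq_complex /= eqxx; apply/eqP; lra.
rewrite [in RHS]mxtrace_mulC /mxtrace rmorph_sum; apply: eq_bigr => i _.
rewrite !mxE rmorph_sum; apply: eq_bigr => j _.
rewrite rmorphM /= -hX mulrC !mxE rmorph_prod; congr (_ * _).
by apply: eq_bigr => k _; exact: pauli1_hermitian.
Qed.

Lemma pauli_expansion n (X : 'M[C]_(2 ^ n)) : is_hermitian X ->
  X = \sum_z (pvec X z)%:C%C *: pauli R z.
Proof.
move=> hX; have N0 : (2 ^+ n : C) != 0 by rewrite expf_neq0 // pnatr_eq0.
apply/matrixP => i j; apply: (mulfI N0); rewrite summxE mulr_sumr.
(* By completeness only the entry X i j survives in the expanded trace, with weight 2^n. *)
transitivity (\sum_z \tr (pauli R z *m X) * pauli R z i j).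
  rewrite /mxtrace; under eq_bigr do rewrite mulr_suml.
  rewrite exchange_big (bigD1 j) //= [X in _ + X]big1 ?addr0 => [|k kj].
    under eq_bigr do rewrite mxE mulr_suml.
    rewrite exchange_big (bigD1 i) //= [X in _ + X]big1 ?addr0 => [|l li].
      under eq_bigr do rewrite mulrAC.
      by rewrite -mulr_suml pauli_completeness !eqxx.
    under eq_bigr do rewrite mulrAC.
    by rewrite -mulr_suml pauli_completeness (negbTE li) andbF mul0r.
  under eq_bigr do rewrite mxE mulr_suml.
  rewrite exchange_big big1 // => l _.
  under eq_bigr do rewrite mulrAC.
  by rewrite -mulr_suml pauli_completeness (negbTE kj) mul0r.
apply: eq_bigr => z _; rewrite [in LHS]trace_pauli_hermitian // [in RHS]mxE /pvec mulrA; congr (_ * _).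
have -> : (2 ^+ n : C) = (2 ^+ n : R)%:C%C by rewrite rmorphXn rmorph_nat.
by rewrite -rmorphM /= mulrA mulfV ?mul1r // expf_neq0 // pnatr_eq0.
Qed.

Lemma pvec_trace n (X H : 'M[C]_(2 ^ n)) : is_hermitian X ->
  Re (\tr (X *m H)) = \sum_z Re (\tr (pauli R z *m H)) * pvec X z.
Proof.
move=> /pauli_expansion {1}->; rewrite mulmx_suml [\tr _]raddf_sum raddf_sum.
by apply: eq_bigr => z _; rewrite /= -scalemxAl mxtraceZ Re_realM mulrC.
Qed.

(** * Channels and circuits acting on Pauli vectors *)

Lemma channel_sum a b (Phi : 'M[C]_(2 ^ a) -> 'M[C]_(2 ^ b)) (J : finType)
    (c : J -> C) (F : J -> 'M[C]_(2 ^ a)) : is_channel Phi ->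
  Phi (\sum_j c j *: F j) = \sum_j c j *: Phi (F j).
Proof.
case=> lin _ _.
have Phi0 : Phi 0 = 0.
  apply: (addIr (Phi 0)); rewrite add0r.
  by have := lin 1 0 0; rewrite !scale1r addr0 => <-.
by elim/big_rec2: _ => // j y x _ <-; exact: lin.
Qed.

(** Expand X in Paulis; its coefficients are real, so they pass through the real part taken in
    [repmx]. *)
Lemma pvec_channel a b (Phi : 'M[C]_(2 ^ a) -> 'M[C]_(2 ^ b)) (X : 'M[C]_(2 ^ a)) z :
  is_channel Phi -> is_hermitian X ->
  pvec (Phi X) z = \sum_x repmx Phi z x * pvec X x.
Proof.
move=> ch /pauli_expansion {1}->; rewrite channel_sum // /pvec mulmx_sumr [\tr _]raddf_sum raddf_sum.
rewrite mulr_sumr; apply: eq_bigr => x _.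
by rewrite /= -scalemxAr mxtraceZ Re_realM /repmx mulrCA mulrC.
Qed.

(* is_channel speaks of psdf on 'I_k * 'I_(2 ^ a); the trivial ancilla k = 1 gives positivity. *)
Definition psdmx d (X : 'M[C]_d) : Prop :=
  psdf (fun u w : 'I_1 * 'I_d => X u.2 w.2).

Lemma psdmx_hermitian d (X : 'M[C]_d) : psdmx X -> is_hermitian X.
Proof. by move=> psd i j; exact: (psdf_hermitian (ord0, i) (ord0, j) psd). Qed.

Lemma psdmx_pure d (X : 'M[C]_d) : pure_state X -> psdmx X.
Proof.
move=> [psi [_ ->]] v.
(* The quadratic form of a rank-one projector is a squared modulus. *)
have -> : \sum_s \sum_t (v s)^*%C * (psi *m (map_mx (@conjc R) psi)^T) s.2 t.2 * v t =
    (\sum_s (v s)^*%C * psi s.2 0) * (\sum_s (v s)^*%C * psi s.2 0)^*%C.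
  rewrite rmorph_sum mulr_suml; apply: eq_bigr => s _; rewrite mulr_sumr.
  apply: eq_bigr => t _; rewrite rmorphM /= conjcK mxE big_ord1 !mxE.
  by rewrite -!mulrA; congr (_ * (_ * _)); rewrite mulrC.
exact: mulcJ_ge0.
Qed.

Lemma psdmx_channel a b (Phi : 'M[C]_(2 ^ a) -> 'M[C]_(2 ^ b)) (X : 'M[C]_(2 ^ a)) :
  is_channel Phi -> psdmx X -> psdmx (Phi X).
Proof.
case=> _ _ cp psd.
have := cp 1%N (fun u w => X u.2 w.2) psd.
rewrite /psdmx; congr psdf; apply/funext => u; apply/funext => w.
by congr (Phi _ _ _); apply/matrixP => i j; rewrite mxE.
Qed.

(** Positivity is the invariant carried through the layers; Hermiticity of the intermediate states,
    needed for their Pauli expansions, follows from it. *)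
Lemma psdmx_circ (n : nat -> nat) (Phi : forall k, 'M[C]_(2 ^ n k) -> 'M[C]_(2 ^ n k.+1))
    l (X : 'M[C]_(2 ^ n 0%N)) :
  (forall k, (k < l)%N -> is_channel (Phi k)) -> psdmx X -> psdmx (circ Phi l X).
Proof.
elim: l => // l IH ch psd; apply: (psdmx_channel (ch l (ltnSn l))).
by apply: IH => // k kl; apply: ch; exact: ltnW.
Qed.

Lemma card_pidx n : #|pidx n| = (4 ^ n)%N.
Proof. by rewrite card_ffun !card_ord. Qed.

(** Stated for linear combinations because signed sums of states are not states: each X i is kept
    positive separately, while the layer matrices act linearly on the combined vector. *)
Lemma lpnorm_pvec_circ (n : nat -> nat)
    (Phi : forall k, 'M[C]_(2 ^ n k) -> 'M[C]_(2 ^ n k.+1)) l (p : R) (q : \bar R)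
    (I : finType) (c : I -> R) (X : I -> 'M[C]_(2 ^ n 0%N)) :
  1 <= p -> (0 < q)%E -> (forall k, (k < l)%N -> is_channel (Phi k)) ->
  (forall i, psdmx (X i)) ->
  lpnorm (hconj p) (fun z => \sum_i c i * pvec (circ Phi l (X i)) z) <=
  4 `^ ((\sum_(i < l) (n i.+1)%:R) * Num.max (1 - p^-1) (inv_ext q)) * mupq l Phi p q *
  lpnorm (hconj p) (fun z => \sum_i c i * pvec (X i) z).
Proof.
move=> p1 q0 + psd; set g := Num.max _ _.
elim: l => [_|l IH ch]; first by rewrite /mupq !big_ord0 mul0r powRr0 !mul1r.
have ch' k : (k < l)%N -> is_channel (Phi k) by move=> kl; apply: ch; exact: ltnW.
pose V z := \sum_i c i * pvec (circ Phi l (X i)) z.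
have -> : (fun z => \sum_i c i * pvec (circ Phi l.+1 (X i)) z) =
          (fun z => \sum_x repmx (Phi l) z x * V x).
  apply/funext => z; rewrite /V; under [RHS]eq_bigr do rewrite mulr_sumr.
  rewrite exchange_big; apply: eq_bigr => i _ /=.
  rewrite pvec_channel; [|exact: ch|by apply/psdmx_hermitian/psdmx_circ].
  by rewrite mulr_sumr; apply: eq_bigr => x _; rewrite mulrCA.
have T0 : (0 < #|pidx (n l.+1)|)%N by rewrite card_pidx expn_gt0.
apply: le_trans (lpnorm_mulmx_le (repmx (Phi l)) V T0 p1 q0) _; rewrite -/g.
have G0 : 0 <= groupnorm p q (repmx (Phi l)).
  by rewrite groupnormE // mulr_ge0 ?powR_ge0 ?lpnorm_ge0.
have A0 : 0 <= #|pidx (n l.+1)|%:R `^ g * groupnorm p q (repmx (Phi l)).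
  by rewrite mulr_ge0 ?powR_ge0.
apply: le_trans (ler_wpM2l A0 (IH ch')) _.
rewrite /mupq !big_ord_recr /= card_pidx natrX -powR_mulrn // -powRrM mulrDl powRDpos //.
by rewrite le_eqVlt; apply/orP; left; apply/eqP; ring.
Qed.

End PauliVectors.

(** * Rademacher complexity *)

Section RademacherBounds.
Variables (R : realType) (X : Type) (m : nat) (S : 'I_m -> X).

Lemma rademacher_le (G : set (X -> R)) (F : {ffun 'I_m -> bool} -> R) (K : R) :
  (forall (e : {ffun 'I_m -> bool}) g, G g -> `|\sum_(i < m) rsign R (e i) * g (S i)| <= F e) ->
  \sum_e F e <= #|{ffun 'I_m -> bool}|%:R * K ->
  (rademacher S G <= (m%:R^-1 * K)%:E)%E.
Proof.
move=> GF FK; rewrite /rademacher.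
apply: (@le_trans _ _ (((2 ^+ m)^-1)%:E * \sum_(e : {ffun 'I_m -> bool}) (m%:R^-1 * F e)%:E)%E).
  apply: lee_wpmul2l; first by rewrite lee_fin invr_ge0 exprn_ge0.
  apply: lee_sum => e _; rewrite EFinM; apply: lee_wpmul2l; first by rewrite lee_fin invr_ge0 ler0n.
  by apply: ge_ereal_sup => _ [g Gg <-]; rewrite lee_fin; exact: GF.
rewrite sumEFin -EFinM lee_fin -mulr_sumr mulrCA ler_wpM2l ?invr_ge0 ?ler0n //.
rewrite mulrC ler_pdivrMr ?exprn_gt0 // mulrC; apply: (le_trans FK).
by rewrite card_ffun card_bool card_ord natrX.
Qed.

Variables (l : nat) (n : nat -> nat) (mu p : R) (q : \bar R).
Variables (rho : X -> 'M[R[i]]_(2 ^ n 0%N)) (H : 'M[R[i]]_(2 ^ n l)).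
Hypotheses (p1 : 1 <= p) (q0 : (0 < q)%E) (rho_pure : forall x, pure_state (rho x)).

Local Notation alpha := (lpnorm p%:E (fun z => complex.Re (\tr (pauli R z *m H)))).
Local Notation growth :=
  (4 `^ ((\sum_(i < l) (n i.+1)%:R) * Num.max (1 - p^-1) (inv_ext q))).
Local Notation signed_input e :=
  (fun z => \sum_(i < m) rsign R (e i) * pvec (rho (S i)) z).

(** Pairing alpha with the signed sum of output vectors, Hölder splits off alpha and the layer bound
    removes the circuit. The right side no longer depends on g. *)
Lemma circ_class_correlation (e : {ffun 'I_m -> bool}) g :
  circ_class p q mu rho H g ->
  `|\sum_(i < m) rsign R (e i) * g (S i)| <=
  mu * growth * alpha * lpnorm (hconj p) (signed_input e).
Proof.
case=> Phi [ch mupq_le ->].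
have psd i : psdmx (rho (S i)) by exact: psdmx_pure.
have -> : \sum_i rsign R (e i) * complex.Re (\tr (circ Phi l (rho (S i)) *m H)) =
    \sum_z complex.Re (\tr (pauli R z *m H)) *
      \sum_i rsign R (e i) * pvec (circ Phi l (rho (S i))) z.
  under [RHS]eq_bigr do rewrite mulr_sumr.
  rewrite [RHS]exchange_big /=; apply: eq_bigr => i _.
  rewrite pvec_trace; last by apply/psdmx_hermitian/psdmx_circ.
  by rewrite mulr_sumr; apply: eq_bigr => z _; rewrite mulrCA.
apply: (le_trans (lpnorm_holder _ _ p1)).
rewrite [_ * alpha]mulrC -mulrA; apply: ler_wpM2l; first exact: lpnorm_ge0.
apply: (le_trans (lpnorm_pvec_circ (fun i => rsign R (e i)) p1 q0 ch psd)).
apply: ler_wpM2r; first exact: lpnorm_ge0.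
by rewrite mulrC; apply: ler_wpM2r; first exact: powR_ge0.
Qed.

Local Notation input_bound :=
  (\big[Num.max/0]_(i < m) lpnorm (hconj p) (pvec (rho (S i)))).

(** Isolates in D the only estimate that differs between the two ranges of p: the mean p*-norm of
    the signed inputs. *)
Lemma rademacher_circ_class_le (D : R) : 0 < mu ->
  \sum_(e : {ffun 'I_m -> bool}) lpnorm (hconj p) (signed_input e) <=
    #|{ffun 'I_m -> bool}|%:R * (D * input_bound) ->
  (rademacher S (circ_class p q mu rho H) <=
    (mu * growth * (m%:R^-1 * D) * Kp p S rho H)%:E)%E.
Proof.
move=> mu0 hD; set c := mu * growth * alpha.
have c0 : 0 <= c by rewrite !mulr_ge0 ?powR_ge0 ?lpnorm_ge0 // ltW.
have -> : mu * growth * (m%:R^-1 * D) * Kp p S rho H = m%:R^-1 * (c * (D * input_bound)).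
  by rewrite /c /Kp -/(input_bound); move: alpha growth input_bound m%:R^-1 => *; ring.
apply: (rademacher_le (F := fun e => c * lpnorm (hconj p) (signed_input e))).
  by move=> e g; exact: circ_class_correlation.
by rewrite -mulr_sumr mulrCA; exact: ler_wpM2l.
Qed.

End RademacherBounds.

Unset Implicit Arguments.

Theorem mainTheorem5 (R : realType) (X : Type) (l : nat) (n : nat -> nat)
  (mu p : R) (q : \bar R)
  (rho : X -> 'M[R[i]]_(2 ^ n 0%N)) (H : 'M[R[i]]_(2 ^ n l))
  (m : nat) (S : 'I_m -> X) :
  (0 < l)%N -> (forall i, (i <= l)%N -> (0 < n i)%N) ->
  0 < mu -> 1 <= p -> (0 < q)%E ->
  (forall x, pure_state (rho x)) -> is_hermitian H -> (0 < m)%N ->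
  (p <= 2 ->
     (rademacher S (@circ_class R X l n p q mu rho H) <=
      (mu * 4 `^ ((\sum_(i < l) (n i.+1)%:R) * Num.max (1 - p^-1) (inv_ext q))
          * Num.sqrt (minconj p (8 * (n 0%N)%:R)) / Num.sqrt m%:R
          * Kp p S rho H)%:E)%E)
  /\
  (2 < p ->
     (rademacher S (@circ_class R X l n p q mu rho H) <=
      (mu * 4 `^ ((\sum_(i < l) (n i.+1)%:R) * Num.max (1 - p^-1) (inv_ext q))
          * Num.sqrt (p / (p - 1)) / (m%:R `^ p^-1)
          * Kp p S rho H)%:E)%E).
Proof.
move=> _ n_gt0 mu0 p1 q0 pure _ m0.
have mpos : 0 < m%:R :> R by rewrite ltr0n.
have I0 : (0 < #|'I_m|)%N by rewrite card_ord.
pose B := \big[Num.max/0]_(i < m) lpnorm (hconj p) (pvec (rho (S i))).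
have B0 : 0 <= B.
  apply: le_trans (le_bigmax 0 _ (Ordinal m0)); exact: lpnorm_ge0.
have vB i : lpnorm (hconj p) (pvec (rho (S i))) <= B.
  exact: (le_bigmax 0 (fun i => lpnorm (hconj p) (pvec (rho (S i)))) i).
split=> [p2|p2].
  have := sum_lpnorm_hconj_rsign I0 (n_gt0 0%N isT) (card_pidx (n 0%N)) p1 p2 B0 vB.
  move=> /(rademacher_circ_class_le H p1 q0 pure mu0); rewrite card_ord.
  suff -> : m%:R^-1 * (Num.sqrt (minconj p (8 * (n 0%N)%:R)) * Num.sqrt m%:R) =
      Num.sqrt (minconj p (8 * (n 0%N)%:R)) / Num.sqrt m%:R by rewrite [_ * (_ / Num.sqrt _)]mulrA.
  rewrite mulrCA; congr (_ * _); rewrite -{1}(sqr_sqrtr (ltW mpos)) expr2 invfM -mulrA.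
  by rewrite mulVf ?mulr1 // gt_eqF // sqrtr_gt0.
have p0 : 0 < p by exact: lt_trans p2.
have pgt1 : 1 < p by apply: lt_trans p2; rewrite ltr1n.
have hE : hconj p = (p / (p - 1))%:E by rewrite /hconj gt_eqF.
have r1 : 1 <= p / (p - 1) by rewrite -lee_fin -hE hconj_ge1.
(* For p > 2 the conjugate exponent lies in [1, 2], where the Khintchine constant is 1. *)
have r2 : p / (p - 1) <= 2 by rewrite ler_pdivrMr ?subr_gt0 //; lra.
have hD : \sum_(e : {ffun 'I_m -> bool}) lpnorm (hconj p)
      (fun z => \sum_(i < m) rsign R (e i) * pvec (rho (S i)) z) <=
    #|{ffun 'I_m -> bool}|%:R * (Num.sqrt (p / (p - 1)) * m%:R `^ (p / (p - 1))^-1 * B).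
  rewrite hE in vB *.
  apply: (le_trans (sum_lpnorm_rsign_le2 r1 r2 B0 vB)).
  rewrite card_ord ler_wpM2l ?ler0n // ler_wpM2r // ler_peMl ?powR_ge0 //.
  by rewrite -[leLHS]sqrtr1 ler_wsqrtr.
move: hD => /(rademacher_circ_class_le H p1 q0 pure mu0).
suff -> : m%:R^-1 * (Num.sqrt (p / (p - 1)) * m%:R `^ (p / (p - 1))^-1) =
    Num.sqrt (p / (p - 1)) / m%:R `^ p^-1 by rewrite [_ * (_ / _ `^ p^-1)]mulrA.
rewrite mulrCA; congr (_ * _); rewrite invf_div mulrBl mul1r divff ?gt_eqF //.
by rewrite powRDpos // powRr1 ?(ltW mpos) // mulrA mulVf ?gt_eqF // mul1r powRN.
Qed.
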